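(* Let $r$ and $n$ be coprime integers with $1\le r\le n-1$. The Weyl group element $c_{r,n}=w_{r,n}v_{r,n}^{-1}\in S_n$ is a Coxeter element.
   Context: $W=S_n$ is the Weyl group of $SL(n,\mathbb{C})$, generated by the simple reflections $s_i=(i,i+1)$, $1\le i\le n-1$. An element $c\in W$ is called a Coxeter element if each simple reflection occurs exactly once in a reduced expression for $c$. An increasing $r$-tuple $(b_1<\dots<b_r)$ in $\{1,\dots,n\}$ is identified with the minimal-length coset representative $w\in S_n$ satisfying $w(i)=b_i$ for $1\le i\le r$ and $w(r+1)<\dots<w(n)$. For $1\le i\le r$, let $a_i$ be the smallest integer with $a_i r\ge i n$. Then $w_{r,n}=(a_1,\dots,a_r)$ (the index of the unique minimal Schubert variety $X(w_{r,n})$ of the Grassmannian $G_{r,n}$ admitting semistable points for the diagonal torus with respect to the line bundle $\mathcal{L}(n\omega_r)$), and $v_{r,n}=(1,a_1,\dots,a_{r-1})$ (the index for which $X^{v_{r,n}}_{w_{r,n}}$ is the smallest Richardson variety in $X(w_{r,n})$ admitting semistable points). *)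

(* Defs.v *)
From HB Require Import structures.
From mathcomp Require Import all_boot all_fingroup.
From mathcomp Require Import zify.

Set Implicit Arguments.
Unset Strict Implicit.
Unset Printing Implicit Defensive.

(* The point k of {1, ..., n} is the ordinal of value k - 1 in 'I_n; tuples   *)
(* of points are kept as sequences of 1-based naturals.                       *)

(* Composition of functions, x |-> u (v x): the product of 'S_n in the        *)
(* convention w v (i) = w (v (i)).  The product _ * _ of perm.v composes in   *)
(* the opposite order.                                                        *)
Definition permc n (u v : 'S_n) : 'S_n := (v * u)%g.

Definition simple_refl n (s : 'S_n) : bool :=
  [exists i : 'I_n, [exists j : 'I_n, (j == i.+1 :> nat) && (s == tperm i j)]].

Definition expression n (t : seq 'S_n) (c : 'S_n) : Prop :=
  all (@simple_refl n) t /\ foldr (@permc n) 1%g t = c.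

Definition reduced_expression n (t : seq 'S_n) (c : 'S_n) : Prop :=
  expression t c /\ forall t' : seq 'S_n, expression t' c -> size t <= size t'.

Definition is_Coxeter n (c : 'S_n) : Prop :=
  exists2 t : seq 'S_n, reduced_expression t c &
    forall s : 'S_n, simple_refl s -> count_mem s t = 1.

Definition increasing_tuple (n : nat) (b : seq nat) : bool :=
  sorted ltn b && all (fun x => 0 < x <= n) b.

Definition is_coset_rep n (b : seq nat) (w : 'S_n) : bool :=
  [forall i : 'I_n, (i < size b) ==> ((w i).+1 == nth 0 b i)]
  && [forall i : 'I_n, [forall j : 'I_n, (size b <= i < j) ==> (w i < w j)]].

(* Meaningful when b is an increasing tuple, see coset_repP and               *)
(* is_coset_rep_uniq; the value is 1 when no permutation qualifies.           *)
Definition coset_rep n (b : seq nat) : 'S_n :=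
  odflt 1%g [pick w : 'S_n | is_coset_rep b w].

Lemma is_coset_rep_exists n b :
  increasing_tuple n b -> exists w : 'S_n, is_coset_rep b w.
Proof.
case/andP=> sb /allP rb.
pose l := b ++ [seq x <- iota 1 n | x \notin b].
have ub : uniq b by apply: (sorted_uniq ltn_trans ltnn).
have ul : uniq l.
  rewrite cat_uniq ub filter_uniq ?iota_uniq // andbT /=.
  by apply/hasPn => x; rewrite mem_filter => /andP[].
have ml x : (x \in l) = (x \in iota 1 n).
  rewrite mem_cat mem_filter; case: (boolP (x \in b)) => //= /rb.
  by rewrite mem_iota add1n ltnS.
have sl : size l = n.
  by rewrite -[RHS](size_iota 1 n); apply/perm_size/uniq_perm; rewrite ?iota_uniq.
have nl (i : 'I_n) : 0 < nth 0 l i <= n.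
  have := mem_nth 0 (_ : i < size l); rewrite sl ml mem_iota add1n ltnS.
  exact.
have fP (i : 'I_n) : (nth 0 l i).-1 < n by have := nl i; lia.
pose f i := Ordinal (fP i).
have fI : injective f.
  move=> i j [] e; apply/val_inj/eqP.
  rewrite -(nth_uniq 0 _ _ ul) ?sl ?ltn_ord //; apply/eqP => /=.
  by have := nl i; have := nl j; move: e; lia.
have fE i : (perm fI i).+1 = nth 0 l i by rewrite permE /=; have := nl i; lia.
exists (perm fI); apply/andP; split.
  by apply/forallP => i; apply/implyP => ib; rewrite fE nth_cat ib.
apply/forallP => i; apply/forallP => j; apply/implyP => /andP[bi ij].
rewrite -ltnS !fE !nth_cat !ltnNge bi (leq_trans bi (ltnW ij)) /= -ltnNge.
have sF : sorted ltn [seq x <- iota 1 n | x \notin b].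
  by apply: (sorted_filter ltn_trans); apply: iota_ltn_sorted.
have sz := sl; rewrite size_cat in sz.
have in_F (k : 'I_n) : size b <= k ->
    k - size b < size [seq x <- iota 1 n | x \notin b].
  by move=> bk; rewrite ltn_subLR // sz.
apply: (sorted_ltn_nth ltn_trans) => //; last by lia.
  by rewrite inE in_F.
by rewrite inE in_F // (leq_trans bi (ltnW ij)).
Qed.

Lemma coset_repP n b : increasing_tuple n b -> is_coset_rep b (coset_rep n b).
Proof.
move=> /is_coset_rep_exists[w hw]; rewrite /coset_rep.
by case: pickP => [//|/(_ w)]; rewrite hw.
Qed.

Lemma is_coset_rep_uniq n b (w w' : 'S_n) :
  is_coset_rep b w -> is_coset_rep b w' -> w = w'.
Proof.
move=> /andP[/forallP wb /forallP wi] /andP[/forallP wb' /forallP wi'].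
have lowE (i : 'I_n) : i < size b -> w i = w' i.
  move=> ib; apply/val_inj; apply: succn_inj.
  by rewrite (eqP (implyP (wb i) ib)) (eqP (implyP (wb' i) ib)).
pose high := [seq i : 'I_n <- enum 'I_n | size b <= i].
have mem_high (i : 'I_n) : (i \in high) = (size b <= i).
  by rewrite mem_filter mem_enum andbT.
have high_sorted : sorted (fun i j : 'I_n => i < j) high.
  apply: sorted_filter; first by move=> ? ? ?; apply: ltn_trans.
  by have := iota_ltn_sorted 0 n; rewrite -val_enum_ord sorted_map.
have img_sorted (u : 'S_n) :
    (forall i : 'I_n, [forall j : 'I_n, (size b <= i < j) ==> (u i < u j)]) ->
  sorted (fun i j : 'I_n => i < j) (map u high).
  move=> ui; pose P := [pred i : 'I_n | size b <= i].
  apply: (@homo_sorted_in _ _ P) high_sorted.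
    by move=> i j bi _ ij; apply: (implyP (forallP (ui i) j)); apply/andP.
  by apply/allP => i; rewrite mem_high.
have in_img (u : 'S_n) y : (y \in map u high) = (size b <= (u^-1)%g y).
  by rewrite -{1}(permKV u y) mem_map ?mem_high //; exact: perm_inj.
have img_eq : map w high = map w' high.
  apply: (@irr_sorted_eq _ (fun i j : 'I_n => i < j)).
  - by move=> ? ? ?; apply: ltn_trans.
  - by move=> ?; apply: ltnn.
  - exact: img_sorted.
  - exact: img_sorted.
  move=> y; rewrite !in_img [LHS]leqNgt [RHS]leqNgt; congr (~~ _).
  apply/idP/idP => yb.
    by rewrite -{1}(permKV w y) lowE // permK.
  by rewrite -{1}(permKV w' y) -lowE // permK.
apply/permP => i; case: (ltnP i (size b)) => [/lowE //|].
by rewrite -mem_high; move: i; apply/eq_in_map.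
Qed.

Lemma a_exists n r i : 0 < r -> exists a, i * n <= a * r.
Proof. by move=> r_gt0; exists (i * n); rewrite leq_pmulr. Qed.

Definition a_index n r (r_gt0 : 0 < r) (i : nat) : nat :=
  ex_minn (a_exists n i r_gt0).

Definition w_tuple n r (r_gt0 : 0 < r) : seq nat :=
  [seq a_index n r_gt0 i | i <- iota 1 r].

Definition v_tuple n r (r_gt0 : 0 < r) : seq nat :=
  1 :: [seq a_index n r_gt0 i | i <- iota 1 r.-1].

Lemma a_indexP n r (r_gt0 : 0 < r) i a :
  (a_index n r_gt0 i <= a) = (i * n <= a * r).
Proof.
rewrite /a_index; case: ex_minnP => m hm min_m.
apply/idP/idP => [ma|/min_m //].
by apply: leq_trans hm _; rewrite leq_mul2r ma orbT.
Qed.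

Lemma a_index_incr n r (r_gt0 : 0 < r) i :
  r < n -> a_index n r_gt0 i < a_index n r_gt0 i.+1.
Proof.
move=> rn; rewrite ltnNge a_indexP -ltnNge.
have [->|i_gt0] := posnP (a_index n r_gt0 i); first by rewrite mul0n; lia.
have : ~~ (a_index n r_gt0 i <= (a_index n r_gt0 i).-1) by lia.
by rewrite a_indexP -ltnNge; nia.
Qed.

Lemma a_index_sorted n r (r_gt0 : 0 < r) m k :
  r < n -> sorted ltn [seq a_index n r_gt0 i | i <- iota m k].
Proof.
move=> rn; rewrite sorted_map; apply: sub_sorted (iota_ltn_sorted m k).
by apply: (homo_ltn ltn_trans) => i; exact: a_index_incr.
Qed.

Lemma w_tuple_incr n r (r_gt0 : 0 < r) :
  r < n -> increasing_tuple n (w_tuple n r_gt0).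
Proof.
move=> rn; apply/andP; split; first exact: a_index_sorted.
apply/allP => x /mapP[i]; rewrite mem_iota => ir ->.
by rewrite a_indexP ltnNge a_indexP; nia.
Qed.

Lemma v_tuple_incr n r (r_gt0 : 0 < r) :
  r < n -> increasing_tuple n (v_tuple n r_gt0).
Proof.
move=> rn; have a_gt1 i : 0 < i -> 1 < a_index n r_gt0 i.
  by move=> i_gt0; rewrite ltnNge a_indexP; nia.
apply/andP; split.
  rewrite /v_tuple /= (path_sortedE ltn_trans) a_index_sorted // andbT.
  apply/allP => x /mapP[i]; rewrite mem_iota => /andP[i_gt0 _] ->.
  exact: a_gt1.
apply/allP => x; rewrite inE => /predU1P[->|/mapP[i]]; first by lia.
rewrite mem_iota => ir ->; rewrite a_indexP.
by have := a_gt1 i; nia.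
Qed.

Definition w_elt n r (r_gt0 : 0 < r) : 'S_n := coset_rep n (w_tuple n r_gt0).

Definition v_elt n r (r_gt0 : 0 < r) : 'S_n := coset_rep n (v_tuple n r_gt0).

Definition c_elt n r (r_gt0 : 0 < r) : 'S_n :=
  permc (w_elt n r_gt0) (v_elt n r_gt0)^-1%g.

(* Main.v *)
Require Import Defs.
From mathcomp Require Import all_boot all_fingroup.
From mathcomp Require Import zify.

(** Write [1 :: s] for the tuple of [v] and [rcons s n] for the tuple of [w];
    for the tuples at hand this is possible because the last [a]-index is [n].
    Then [c = w v^-1] sends each entry of [1 :: s] to the next larger entry of
    [rcons s n], and it sends the remaining points [b_1 < ... < b_m < n], in
    order, to [1 < b_1 < ... < b_m].  So [c] is the cycle that climbs from 1 to
    [n] through [s] and comes down through the [b_j].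

    Such a cycle is built one point at a time.  Given the cycle on
    [1, ..., k], multiplying by [s_k = (k, k+1)] on the right inserts [k+1] just
    after [k], which is correct when [k] is on the climbing side, and
    multiplying on the left inserts [k+1] just before [k], which is correct when
    [k] is on the descending side ([cycle_invariant_S]).  The resulting word
    contains every simple reflection exactly once.  The invariant kept along
    the way is just enough to see that the product times [v] is the minimal
    coset representative of [rcons s n] ([updown_prod_eq]).

    Finally, a word with every simple reflection exactly once is automatically
    reduced ([count1_reduced]): a product that avoids [s_k] preserves
    [{1, ..., k}], and a product in which [s_k] occurs once does not, so
    every expression of the same element contains all simple reflections. *)

Set Implicit Arguments.
Unset Strict Implicit.
Unset Printing Implicit Defensive.

(** * Words in simple reflections *)

Definition word_prod n (t : seq 'S_n) : 'S_n := foldr (@permc n) 1%g t.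

Lemma permcE n (u v : 'S_n) x : permc u v x = u (v x).
Proof. by rewrite /permc permM. Qed.

Lemma word_prod_cons n (s : 'S_n) t x :
  word_prod (s :: t) x = s (word_prod t x).
Proof. exact: permcE. Qed.

Lemma word_prod_cat n (t1 t2 : seq 'S_n) x :
  word_prod (t1 ++ t2) x = word_prod t1 (word_prod t2 x).
Proof.
elim: t1 => [|s t1 IH]; first by rewrite /= perm1.
by rewrite cat_cons !word_prod_cons IH.
Qed.

(** Adjacent transpositions other than [(i, i+1)] preserve the initial segment
    ending at [i]. *)
Lemma word_prod_initial n (i j : 'I_n) (t : seq 'S_n) x :
    j = i.+1 :> nat -> all (@simple_refl n) t -> tperm i j \notin t ->
  (word_prod t x <= i) = (x <= i).
Proof.
move=> ij; elim: t => [|s t IH] /=; first by rewrite perm1.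
case/andP=> /existsP[k /existsP[l /andP[/eqP kl /eqP ->]]] t_simple.
rewrite inE negb_or => /andP[neq_s nt].
rewrite word_prod_cons -(IH t_simple nt).
have neq_ki : k <> i :> nat.
  move=> /val_inj eq_ki; case/eqP: neq_s; rewrite eq_ki; congr tperm.
  by apply: val_inj; rewrite /= ij kl eq_ki.
by case: tpermP => [->|->|//]; apply/idP/idP; lia.
Qed.

(** Each simple reflection [s] of [t] must occur in any other expression [t'] of
    the same element: otherwise the product preserves the initial segment that
    [s] breaks, while the two parts of [t] around [s] preserve it as well. *)
Lemma count1_reduced n (t : seq 'S_n) :
    all (@simple_refl n) t ->
    (forall s : 'S_n, simple_refl s -> count_mem s t = 1) ->
  reduced_expression t (word_prod t).
Proof.
move=> t_simple t_count; split=> // t' [t'_simple t'_prod].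
have t_uniq : uniq t.
  apply: count_mem_uniq => s; case: (boolP (s \in t)) => [st|/count_memPn //].
  by rewrite t_count // (allP t_simple).
apply: uniq_leq_size => // s st; apply: contraT => nst'.
have s_simple := allP t_simple _ st; have s_count := t_count s s_simple.
have [i /existsP[j /andP[/eqP ij /eqP def_s]]] := existsP s_simple.
rewrite def_s in nst'.
case/splitPr: st t_simple s_count t'_prod => t1 t2.
rewrite all_cat /= => /and3P[t1_simple _ t2_simple].
rewrite count_cat /= eqxx => s_count t'_prod.
have [nt1 nt2] : tperm i j \notin t1 /\ tperm i j \notin t2.
  move: s_count; rewrite -def_s addnCA add1n => -[] /eqP; rewrite addn_eq0.
  by case/andP=> /eqP/count_memPn ? /eqP/count_memPn.
(* The point that the part after s sends to i is moved across the boundary. *)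
pose x := ((word_prod t2)^-1)%g i.
have x_le : x <= i by rewrite -(word_prod_initial x ij t2_simple nt2) permKV.
have := word_prod_initial x ij t'_simple nst'.
rewrite -[foldr _ _ _]/(word_prod t') in t'_prod.
rewrite t'_prod -/(word_prod _) word_prod_cat word_prod_cons.
rewrite (word_prod_initial _ ij t1_simple nt1) permKV def_s tpermL x_le.
by rewrite ij ltnn.
Qed.

(** * The climbing and descending cycle *)

Definition sref m (k : nat) : 'S_m.+1 := tperm (inord k) (inord k.+1).

Lemma srefE m k (x : 'I_m.+1) : k < m ->
  sref m k x = (if x == k :> nat then k.+1
                else if x == k.+1 :> nat then k else x) :> nat.
Proof.
move=> km; rewrite /sref; have ik : (inord k : 'I_m.+1) = k :> nat.
  by rewrite inordK //; lia.
have ik1 : (inord k.+1 : 'I_m.+1) = k.+1 :> nat by rewrite inordK //; lia.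
case: tpermP => [->|->|/eqP xk /eqP xk1].
- by rewrite ik ik1 eqxx.
- by rewrite ik ik1 eqxx; case: eqP => //; lia.
- by move: xk xk1; rewrite -!val_eqE /= ik ik1 => /negbTE-> /negbTE->.
Qed.

Lemma simple_sref m k : k < m -> simple_refl (sref m k).
Proof.
move=> km; apply/existsP; exists (inord k); apply/existsP; exists (inord k.+1).
by rewrite eqxx andbT !inordK //; lia.
Qed.

Lemma simple_reflE m (s : 'S_m.+1) :
  simple_refl s -> exists2 k, k < m & s = sref m k.
Proof.
case/existsP=> i /existsP[j /andP[/eqP ij /eqP->]].
exists i; first by have := ltn_ord j; rewrite ij.
by rewrite /sref -ij !inord_val.
Qed.

Lemma sref_inj m : {in iota 0 m &, injective (sref m)}.
Proof.
move=> k l; rewrite !mem_iota /= => km lm eq_kl.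
have ik : (inord k : 'I_m.+1) = k :> nat by rewrite inordK //; lia.
have := srefE (inord k) km; rewrite eq_kl srefE // ik eqxx.
by case: eqP => [->|_] //; case: eqP; lia.
Qed.

Section UpDown.

Variables (m : nat) (A : pred nat).

(** [A] marks the climbing points, numbered from 0 like the elements of
    ['I_m.+1]. *)
Fixpoint updown_word k : seq 'S_m.+1 :=
  if k is k'.+1 then
    if A k' then updown_word k' ++ [:: sref m k'] else sref m k' :: updown_word k'
  else [::].

Lemma perm_updown_word k : perm_eq (updown_word k) (map (sref m) (iota 0 k)).
Proof.
elim: k => // k IH.
have -> : iota 0 k.+1 = rcons (iota 0 k) k by rewrite -addn1 iotaD cats1.
rewrite map_rcons perm_sym perm_rcons perm_sym /=; case: (A k).
  by rewrite cats1 perm_rcons perm_cons.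
by rewrite perm_cons.
Qed.

Lemma updown_word_reduced :
  reduced_expression (updown_word m) (word_prod (updown_word m)) /\
  forall s : 'S_m.+1, simple_refl s -> count_mem s (updown_word m) = 1.
Proof.
have t_count (s : 'S_m.+1) : simple_refl s -> count_mem s (updown_word m) = 1.
  move=> /simple_reflE[k km ->]; rewrite (seq.permP (perm_updown_word m)).
  rewrite count_uniq_mem; last by rewrite (map_inj_in_uniq (@sref_inj m)) iota_uniq.
  by rewrite map_f // mem_iota.
split=> //; apply: count1_reduced => //.
rewrite (perm_all _ (perm_updown_word m)).
by apply/allP => s /mapP[k]; rewrite mem_iota => km ->; apply: simple_sref.
Qed.

(** What is needed of the cycle on [0, ..., k] that climbs through [A] to [k]
    and descends through the other points: it is the identity elsewhere, a
    climbing point goes to the next one, and a descending point [x] goes down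
    without jumping over another descending point.  The top [k] is the end of
    the climb and the start of the descent, so both clauses admit it whatever
    [A k] is; at [k = 0] there is no cycle yet, whence the first disjunct. *)
Definition cycle_invariant k (c : 'S_m.+1) : Prop :=
  [/\ forall x : 'I_m.+1, (k == 0) || (k < x) -> c x = x,
      forall (x : 'I_m.+1) y, A x -> x < y <= k -> A y || (y == k) ->
        (forall z, x < z < y -> ~~ A z) -> c x = y :> nat
    & forall x : 'I_m.+1, 0 < x <= k -> ~~ A x || (x == k :> nat) ->
        c x < x /\ forall z, z < x -> ~~ A z -> z <= c x].

Lemma cycle_invariant_S k (c : 'S_m.+1) : k < m -> cycle_invariant k c ->
  cycle_invariant k.+1
    (if A k then permc c (sref m k) else permc (sref m k) c).
Proof.
move=> km [fix_c up_c down_c].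
have k1P : k.+1 < m.+1 by []. have kP : k < m.+1 by apply: ltnW.
have [Ak|nAk] := boolP (A k).
- have sE (x : 'I_m.+1) : x != k :> nat -> x != k.+1 :> nat -> sref m k x = x.
    by move=> /negbTE xk /negbTE xk1; apply/val_inj; rewrite /= srefE // xk xk1.
  have sk : sref m k (Ordinal kP) = Ordinal k1P.
    by apply/val_inj; rewrite /= srefE //= eqxx.
  have sk1 : sref m k (Ordinal k1P) = Ordinal kP.
    by rewrite -sk /sref tpermK.
  split=> [x|x y Ax|x].
  + by move=> kx; rewrite permcE sE ?fix_c //; lia.
  + rewrite permcE => xy Ay btw; have [xk|xk] := eqVneq (x : nat) k.
      have -> : x = Ordinal kP by apply/val_inj.
      by rewrite sk fix_c /=; lia.
    rewrite sE //; last by lia.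
    (* y = k + 1 would leave the climbing point k between x and y. *)
    have yk : y <= k by have := contraL (btw k) Ak; lia.
    by apply: up_c => //; lia.
  + rewrite permcE => xk Ax; have [xk1|xk1] := eqVneq (x : nat) k.+1.
      have -> : x = Ordinal k1P by apply/val_inj.
      rewrite sk1 /=; have [k0|k_gt0] := posnP k.
        by rewrite fix_c /= ?k0 //; split => // z; lia.
      have [] := down_c (Ordinal kP); rewrite /= ?k_gt0 ?leqnn ?eqxx ?orbT //.
      move=> ck_lt ck_ge; split=> [|z z_lt nAz]; first by lia.
      apply: ck_ge => //; have [zk|] := eqVneq z k; last by lia.
      by rewrite zk Ak in nAz.
    have xk' : x != k :> nat by apply/eqP => xk'; move: Ax; rewrite xk' Ak; lia.
    by rewrite sE //; apply: down_c; lia.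
split=> [x|x y Ax|x].
- move=> kx; rewrite permcE fix_c; last by lia.
  apply/val_inj; rewrite /= srefE //.
  by have [-> ->] : (x == k :> nat) = false /\ (x == k.+1 :> nat) = false by lia.
- rewrite permcE => xy Ay btw; rewrite srefE //.
  have xk : x != k :> nat by apply: contraNneq nAk => <-.
  have [yk1|yk1] := eqVneq y k.+1.
    have -> : c x = k :> nat.
      by apply: up_c; rewrite ?eqxx ?orbT //; [lia|move=> z xz; apply: btw; lia].
    by rewrite eqxx yk1.
  have Ay' : A y by move: Ay; rewrite (negbTE yk1) orbF.
  have yk : y != k by apply: contraNneq nAk => <-.
  have -> : c x = y :> nat by apply: up_c; rewrite ?Ay' //; lia.
  by rewrite (negbTE yk) (negbTE yk1).
- rewrite permcE => xk Ax; rewrite srefE //.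
  have [xk1|xk1] := eqVneq (x : nat) k.+1.
    rewrite fix_c ?xk1 ?ltnSn ?orbT // eqxx.
    by have -> : (k.+1 == k) = false by [lia]; split=> // z; lia.
  have [||cx_lt cx_ge] := down_c x; [by lia|by move: Ax; rewrite (negbTE xk1) orbF => ->|].
  have -> : (c x == k :> nat) = false by lia.
  by have -> : (c x == k.+1 :> nat) = false by lia.
Qed.

Lemma updown_invariant k :
  k <= m -> cycle_invariant k (word_prod (updown_word k)).
Proof.
elim: k => [_|k IH km].
  by split=> [x _|x y _|x]; rewrite ?perm1 //; lia.
have := cycle_invariant_S km (IH (ltnW km)); rewrite /=; case: ifP => // _.
congr cycle_invariant; apply/permP => x.
by rewrite permcE word_prod_cat word_prod_cons /= perm1.
Qed.

End UpDown.

(** * Coset representatives of shifted tuples *)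

Lemma coset_rep_notin n (b : seq nat) (v : 'S_n) (i : 'I_n) :
  is_coset_rep b v -> size b <= i -> (v i).+1 \notin b.
Proof.
move=> /andP[/forallP vb _] bi; apply/negP => /(nthP 0)[l lb def_vi].
have ln : l < n by apply: leq_trans (ltnW (ltn_ord i)); apply: leq_trans bi.
have := implyP (vb (Ordinal ln)) lb; rewrite /= def_vi => /eqP[].
by move=> /val_inj/perm_inj eq_il; move: bi; rewrite -eq_il /= leqNgt lb.
Qed.

Lemma sorted_consecutive x0 (b : seq nat) i z :
    sorted ltn b -> i.+1 < size b -> nth x0 b i < z < nth x0 b i.+1 ->
  z \notin b.
Proof.
move=> sb ib bz; apply/negP => /(nthP x0)[j jb def_z].
have [ji|ij] := leqP j i.
  have := sorted_leq_nth leq_trans leqnn x0 (sub_sorted ltnW sb).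
  by move/(_ j i); rewrite !inE def_z => /(_ jb (ltnW ib) ji); lia.
have := sorted_leq_nth leq_trans leqnn x0 (sub_sorted ltnW sb).
by move/(_ i.+1 j); rewrite !inE def_z => /(_ ib jb ij); lia.
Qed.

(** By uniqueness of minimal representatives it suffices that the cycle carries
    [1 :: s] to [rcons s n] and is increasing off [1 :: s]. *)
Lemma updown_prod_eq m (s : seq nat) (v w : 'S_m.+1) :
    path ltn 1 (rcons s m.+1) ->
    is_coset_rep (1 :: s) v -> is_coset_rep (rcons s m.+1) w ->
  permc w v^-1%g = word_prod (updown_word m (fun k => k.+1 \in 1 :: s) m).
Proof.
move=> s_path v_rep w_rep; set A := fun k => _; set c := word_prod _.
have [_ up_c down_c] := updown_invariant A (leqnn m).
suffices /(is_coset_rep_uniq w_rep)-> : is_coset_rep (rcons s m.+1) (permc c v).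
  by apply/permP => x; rewrite !permcE permKV.
have /andP[/forallP vb /forallP v_incr] := v_rep.
apply/andP; split; apply/forallP => i; rewrite size_rcons.
  apply/implyP => i_lt; rewrite permcE.
  have /eqP def_vi := implyP (vb i) i_lt.
  have sb : sorted ltn (1 :: rcons s m.+1) by [].
  have nthE : nth 0 (1 :: rcons s m.+1) i = (v i).+1.
    by rewrite def_vi -rcons_cons nth_rcons i_lt.
  have ltvy : (v i).+1 < nth 0 (rcons s m.+1) i.
    rewrite -nthE; apply: (sorted_ltn_nth ltn_trans 0 sb i i.+1) => //.
      by rewrite inE /= size_rcons; lia.
    by rewrite inE /= size_rcons; lia.
  set y := nth 0 _ i in ltvy *.
  have y_in : y \in rcons s m.+1 by rewrite mem_nth // size_rcons.
  have y_le : y <= m.+1.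
    rewrite /y nth_rcons; case: ltnP => [i_s|_]; last by case: eqP.
    have := sorted_ltn_nth ltn_trans 0 (path_sorted s_path) i (size s).
    rewrite !inE size_rcons ltnSn => /(_ i_lt isT i_s).
    by rewrite !nth_rcons ltnn eqxx i_s => /ltnW.
  rewrite (up_c (v i) y.-1) ?prednK //; first by lia.
  - by rewrite /A def_vi mem_nth.
  - by lia.
  - rewrite /A prednK; last by lia.
    by move: y_in; rewrite mem_rcons !inE => /orP[/eqP->|->]; rewrite ?eqxx ?orbT.
  move=> z vzy; rewrite /A.
  have : z.+1 \notin 1 :: rcons s m.+1.
    apply: (sorted_consecutive (x0 := 0) sb (i := i)); first by rewrite /= size_rcons.
    by rewrite nthE /= -/y; lia.
  by rewrite !inE mem_rcons inE !negb_or => /and3P[-> _ ->].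
apply/forallP => j; apply/implyP => /andP[si ij]; rewrite !permcE.
have sj := leq_trans si (ltnW ij).
have vij : v i < v j by apply: (implyP (forallP (v_incr i) j)); rewrite /= si.
have nAi : ~~ A (v i) := coset_rep_notin v_rep si.
have nAj : ~~ A (v j) := coset_rep_notin v_rep sj.
have vi_gt0 : 0 < v i by rewrite lt0n; apply: contraNneq nAi => ->.
have le_m (x : 'I_m.+1) : x <= m by rewrite -ltnS.
have [||ci _] := down_c (v i); rewrite ?vi_gt0 ?le_m ?nAi //.
have [||_ cj] := down_c (v j); rewrite ?(leq_trans _ vij) ?le_m ?nAj //.
exact: leq_trans ci (cj _ vij nAi).
Qed.

Theorem shifted_tuple_Coxeter n (s : seq nat) (v w : 'S_n) :
    path ltn 1 (rcons s n) ->
    is_coset_rep (1 :: s) v -> is_coset_rep (rcons s n) w ->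
  is_Coxeter (permc w v^-1%g).
Proof.
case: n v w => [|m] v w s_path v_rep w_rep.
  by have := order_path_min ltn_trans s_path; rewrite all_rcons.
rewrite (updown_prod_eq s_path v_rep w_rep).
have [t_red t_count] := updown_word_reduced m (fun k => k.+1 \in 1 :: s).
by exists (updown_word m (fun k => k.+1 \in 1 :: s) m).
Qed.

(** * The tuples of [w] and [v] *)

Lemma a_index_last n r (r_gt0 : 0 < r) : a_index n r_gt0 r = n.
Proof.
apply/eqP; rewrite eqn_leq a_indexP mulnC leqnn /=.
by have := leqnn (a_index n r_gt0 r); rewrite a_indexP mulnC leq_pmul2r.
Qed.

Lemma w_tuple_rcons n r (r_gt0 : 0 < r) :
  w_tuple n r_gt0 = rcons [seq a_index n r_gt0 i | i <- iota 1 r.-1] n.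
Proof.
case: r r_gt0 => // r r_gt0; rewrite /w_tuple.
have -> : iota 1 r.+1 = rcons (iota 1 r) r.+1 by rewrite -{1}(addn1 r) iotaD cats1.
by rewrite map_rcons a_index_last.
Qed.

Theorem claim3p3 (r n : nat) (r_ge1 : 1 <= r) (r_le : r <= n - 1)
  (co_rn : coprime r n) : is_Coxeter (c_elt n r_ge1).
Proof.
have rn : r < n by lia.
have w_rep := coset_repP (w_tuple_incr r_ge1 rn).
have v_rep := coset_repP (v_tuple_incr r_ge1 rn).
have /andP[w_sorted _] := w_tuple_incr r_ge1 rn.
rewrite /c_elt /w_elt /v_elt.
apply: shifted_tuple_Coxeter v_rep _; last by rewrite -w_tuple_rcons.
rewrite -w_tuple_rcons (path_sortedE ltn_trans) w_sorted andbT.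
apply/allP => x /mapP[i]; rewrite mem_iota => /andP[i_gt0 _] ->.
by rewrite /= ltnNge a_indexP; nia.
Qed.
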